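(* Let $g:=\mathbf{1}_{[0,1/2)}-\mathbf{1}_{[1/2,1)}$ on $X=[0,1)$, let $p\in(0,1)$, and let $(k(n))_n$ be a sequence of integers with $0\le k(n)\le n$ and $k(n)/n\to p$. Then $$\varphi^g_{n,k(n)}\ \longrightarrow\ \frac{\mathcal{M}_p}{\|\mathcal{M}_p\|_\infty}\qquad\text{in }L^\infty([0,1])\text{ as }n\to\infty .$$
   Context: Pascal-adic transformation $T$ on $X=[0,1)$ (cutting and stacking). At stage $n\ge1$ there are $n+1$ towers $\tau_{n,0},\dots,\tau_{n,n}$; $\tau_{n,k}$ is an ordered (bottom to top) list of $\binom nk$ disjoint intervals (''rungs'') of the form $[\cdot,\cdot)$ and length $2^{-n}$, and $T$ maps each rung except the top one by translation onto the rung just above it. Start: $\tau_{1,0}$ has the single rung $[0,1/2)$ and $\tau_{1,1}$ the single rung $[1/2,1)$. From stage $n$ to $n+1$: cut each tower into its left-half and right-half sub-columns, and for $0\le k\le n-1$ define $T$ on the right half of the top rung of $\tau_{n,k}$ as the translation onto the left half of the base (bottom rung) of $\tau_{n,k+1}$. Thus $\tau_{n+1,0}$ is the left half of $\tau_{n,0}$, $\tau_{n+1,n+1}$ is the right half of $\tau_{n,n}$, and for $1\le k\le n$, $\tau_{n+1,k}$ is the right half of $\tau_{n,k-1}$ with the left half of $\tau_{n,k}$ stacked on top of it. Iterating defines $T$ on $X$ minus a countable set. The basis of $\tau_{n,k}$ is its bottom rung. For a real function $g$ on $X$, a point $x$ and an integer $\ell\ge1$ such that $x,Tx,\dots,T^{\ell-1}x$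 are defined, $F^g_{x,\ell}:[0,\ell]\to\mathbb{R}$ is given by $F^g_{x,\ell}(0)=0$, $F^g_{x,\ell}(j)=\sum_{i=0}^{j-1}g(T^ix)$ for integers $1\le j\le\ell$, and linear interpolation between integers. Put $R^g_{x,\ell}:=\max_{0\le t\le1}|F^g_{x,\ell}(t\ell)-tF^g_{x,\ell}(\ell)|$ if this is nonzero, and $R^g_{x,\ell}:=1$ otherwise, and $$\varphi^g_{x,\ell}(t):=\frac{F^g_{x,\ell}(t\ell)-tF^g_{x,\ell}(\ell)}{R^g_{x,\ell}},\qquad t\in[0,1].$$ For $g=\mathbf{1}_{[0,1/2)}-\mathbf{1}_{[1/2,1)}$, set $\varphi^g_{n,k}:=\varphi^g_{x,\binom nk}$ for any $x$ in the basis of $\tau_{n,k}$ (this does not depend on the choice of $x$). For $0<p<1$, let $\alpha_p^L(x,y):=(px,\,py+x)$ and $\alpha_p^R(x,y):=\bigl((1-p)x+p,\,(1-p)y-x+1\bigr)$, affine maps of $[0,1]\times\mathbb{R}$ to itself. There is a unique nonempty compact set $E_p\subset[0,1]\times\mathbb{R}$ with $E_p=\alpha_p^L(E_p)\cup\alpha_p^R(E_p)$, and $E_p$ is the graph of a continuous function $\mathcal{M}_p:[0,1]\to\mathbb{R}$; this defines $\mathcal{M}_p$. *)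

(* Defs.v *)
From HB Require Import structures.
From mathcomp Require Import all_boot all_order all_algebra.
From mathcomp Require Import all_classical all_reals all_analysis.
Set Implicit Arguments.
Unset Strict Implicit.
Unset Printing Implicit Defensive.
Import Order.TTheory GRing.Theory Num.Theory.
Import numFieldNormedType.Exports.
Local Open Scope classical_set_scope.
Local Open Scope ring_scope.

Section pascal_adic.
Context {R : realType}.
Implicit Types (g : R -> R) (x y t p : R) (n k l i : nat).

(* [tower n k] lists the left endpoints of the rungs of tau_{n,k}, from bottom
   to top.  There is no stage 0, and [tower n k] is empty for n < k; hence the
   last clause below also covers tau_{n+1,n+1}. *)
Fixpoint tower n k : seq R :=
  match n, k with
  | 0, _ => [::]
  | 1, 0 => [:: 0]
  | 1, 1 => [:: 2^-1]
  | 1, _ => [::]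
  | m.+1, 0 => tower m 0
  | m.+1, j.+1 => [seq a + 2^-1 ^+ m.+1 | a <- tower m j] ++ tower m j.+1
  end.

Definition rung n k i : set R :=
  let a := nth 0 (tower n k) i in `[a, a + 2^-1 ^+ n[.

Definition tower_basis n k : set R := rung n k 0.

Definition pascal_graph x y : Prop :=
  exists n k i, [/\ (0 < n)%N, (k <= n)%N, (i.+1 < size (tower n k))%N,
    rung n k i x & y = x - nth 0 (tower n k) i + nth 0 (tower n k) i.+1].

(* T is only partially defined; off its domain, [pascal x] is the junk value x. *)
Definition pascal x : R := xget x [set y | pascal_graph x y].

Definition birkhoff_sum g x i : R := \sum_(j < i) g (iter j pascal x).

(* F^g_{x,l} is [interp_sum g x] on [0, l]. *)
Definition interp_sum g x t : R :=
  let j := Num.truncn t in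
  (1 - (t - j%:R)) * birkhoff_sum g x j + (t - j%:R) * birkhoff_sum g x j.+1.

Definition bridge g x l t : R :=
  interp_sum g x (t * l%:R) - t * interp_sum g x l%:R.

Definition renorm g x l : R :=
  let r := sup [set `|bridge g x l t| | t in `[0, 1]] in
  if r == 0 then 1 else r.

Definition phi g x l t : R := bridge g x l t / renorm g x l.

Definition alphaL p (z : R * R) : R * R := (p * z.1, p * z.2 + z.1).

Definition alphaR p (z : R * R) : R * R :=
  ((1 - p) * z.1 + p, (1 - p) * z.2 - z.1 + 1).

Definition invariant_compact p (E : set (R * R)) : Prop :=
  [/\ E `<=` `[0, 1] `*` setT, E !=set0, compact E &
      E = alphaL p @` E `|` alphaR p @` E].

Definition curve p : set (R * R) := xget set0 [set E | invariant_compact p E].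

(* The function on [0, 1] whose graph is [curve p] (0 outside [0, 1]). *)
Definition calM p t : R := xget 0 [set y | curve p (t, y)].

(* The norm of L^oo([0, 1]). *)
Definition Linf01 (f : R -> R) : \bar R :=
  Lnorm (mrestr (@lebesgue_measure R) (measurable_itv `[0, 1])) +oo%E (EFin \o f).

Definition g0 : R -> R := \1_(`[0, 2^-1[%classic) \- \1_(`[2^-1, 1[%classic).

End pascal_adic.

(* Main.v *)
Require Import Defs.
From HB Require Import structures.
From mathcomp Require Import all_boot all_order all_algebra.
From mathcomp Require Import all_classical all_reals all_analysis.
From mathcomp Require Import ess_sup_inf.
From mathcomp Require Import ring lra.
Set Implicit Arguments.
Unset Strict Implicit.
Unset Printing Implicit Defensive.
Import Order.TTheory GRing.Theory Num.Theory.
Import numFieldNormedType.Exports.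
Local Open Scope classical_set_scope.
Local Open Scope ring_scope.

(** The values of [g0] along the tower with indices [n], [k] form a word
    [w(n, k)], and cutting and stacking makes [w(n + 1, k + 1)] the concatenation
    of [w(n, k)] and [w(n, k + 1)] ([wordSS]).  The bridge of a concatenation is
    made of the bridges of the two parts, each sheared by a linear function that
    vanishes at the outer end, the common height of the corner at the junction
    being some number [D] ([dev_cat_l], [dev_cat_r]).  For the words of the
    towers the junction is at [k / n] and the corner is
    [D(n, k) = 2 C(n - 2, k - 1) / n] ([corner_word]); hence the ratios
    [D(n - 1, k - 1) / D(n, k)] and [D(n - 1, k) / D(n, k)] tend to [p] and [1 - p]
    when [k / n] tends to [p].  Divided by its corner, the bridge of a tower
    therefore satisfies, up to small errors, the two functional equations
    [M (p s) = p M s + s] and [M (p + (1 - p) s) = (1 - p) M s + (1 - s)] of the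
    limit curve.

    These equations have a continuous solution [limit p], constructed as the limit
    of an increasing sequence of Lipschitz functions with geometrically small
    increments.  Its graph is compact and invariant under the two affine maps, and
    it is the only nonempty compact invariant set: the vertical distance to the
    graph is contracted by both maps, and the projection of an invariant set to
    [[0, 1]] is dense and closed ([invariant_unique]).  So [calM p] is this
    solution.

    If the normalised bridges of [(n, k)] and [(n, k + 1)] are within [e] of the
    limit curve, that of [(n + 1, k + 1)] is within [r e + h] for a fixed [r < 1]
    and an error [h] that is small as long as [n] is large and [k / n] is close to
    [p]; the modulus of continuity of the limit enters because the junction is at
    [k / n] and not at [p] ([close_step]).  Starting near [p n] one can go back a
    number of rows proportional to [n] and still be close to the direction [p],
    where the normalised bridge is at most a constant times [n]; as [r ^ j n] is
    small for [j] proportional to [n], the distance to the limit is at most a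
    multiple of [h] ([close_iter], [close_eventually]).  Uniform convergence of
    the bridges divided by the corners passes to the bridges divided by their
    maxima ([normalized_close]), and the norm of the continuous limit in
    [L^oo([0, 1])] is its maximum ([le_Linf01], [Linf01_calM_lub]).

    The transformation itself enters only through [pascal_rung]: a point on a rung
    is moved to the next rung by the translation of that stage, whichever stage is
    used to compute its image. *)

(** * Rungs and the transformation *)

Section towers.
Context {R : realType}.
Implicit Types (x y a : R) (n k i j m : nat).

Local Notation tower := (@tower R).
Local Arguments Defs.tower : simpl never.
Local Notation level n k i := (nth 0 (tower n k) i).

Lemma half_expS n : (2^-1 ^+ n : R) = 2^-1 ^+ n.+1 + 2^-1 ^+ n.+1.
Proof. by rewrite exprS; field. Qed.

Lemma half_exp_gt0 n : 0 < (2^-1 ^+ n : R).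
Proof. by rewrite exprn_gt0// invr_gt0. Qed.

Lemma towerS0 n : (0 < n)%N -> tower n.+1 0 = tower n 0.
Proof. by case: n. Qed.

Lemma towerSS n k : (0 < n)%N ->
  tower n.+1 k.+1 = [seq a + 2^-1 ^+ n.+1 | a <- tower n k] ++ tower n k.+1.
Proof. by case: n. Qed.

Lemma size_tower n k : (0 < n)%N -> size (tower n k) = 'C(n, k).
Proof.
elim: n k => [//|[_|n IH] [|k] _]; rewrite ?bin0 //.
- by case: k => //= k; rewrite bin_small.
- by rewrite towerS0// IH// bin0.
- by rewrite towerSS// size_cat size_map !IH// binS addnC.
Qed.

Lemma rungE n k i x :
  rung n k i x <-> level n k i <= x < level n k i + 2^-1 ^+ n.
Proof. by rewrite /rung /= in_itv. Qed.

(** Number of rungs that lie below the left half of [tower n k] inside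
    [tower n.+1 k]. *)
Definition left_shift n k : nat := if k is j.+1 then size (tower n j) else 0.

Lemma level_left n k i : (0 < n)%N ->
  level n.+1 k (left_shift n k + i) = level n k i.
Proof.
move=> n0; case: k => [|k] /=; first by rewrite towerS0.
by rewrite towerSS// nth_cat size_map ltnNge leq_addr/= addKn.
Qed.

Lemma size_left n k i : (0 < n)%N -> (i < size (tower n k))%N ->
  (left_shift n k + i < size (tower n.+1 k))%N.
Proof.
move=> n0; case: k => [|k] ilt /=; first by rewrite towerS0.
by rewrite towerSS// size_cat size_map ltn_add2l.
Qed.

Lemma level_right n k i : (0 < n)%N -> (i < size (tower n k))%N ->
  level n.+1 k.+1 i = level n k i + 2^-1 ^+ n.+1.
Proof.
by move=> n0 ilt; rewrite towerSS// nth_cat size_map ilt (nth_map 0).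
Qed.

Lemma size_right n k i : (0 < n)%N -> (i < size (tower n k))%N ->
  (i < size (tower n.+1 k.+1))%N.
Proof. by move=> n0 ilt; rewrite towerSS// size_cat size_map ltn_addr. Qed.

(** Cutting read backwards, for inductions on the stage: the half of the parent
    rung that contains the point determines the tower and the height. *)
Lemma rung_parent n k i x : (0 < n)%N -> (i < size (tower n.+1 k))%N ->
  rung n.+1 k i x -> exists k0 i0,
  [/\ (i0 < size (tower n k0))%N, rung n k0 i0 x &
    ((x < level n k0 i0 + 2^-1 ^+ n.+1) /\ (k = k0 /\ i = left_shift n k0 + i0)%N)
    \/ ((level n k0 i0 + 2^-1 ^+ n.+1 <= x) /\ (k = k0.+1 /\ i = i0))].
Proof.
move=> n0; have hp := half_exp_gt0 n.+1.
case: k => [|k].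
  rewrite towerS0// => ilt /rungE; rewrite towerS0// => /andP[lx xl].
  exists 0%N, i; split=> //; last by left; rewrite xl.
  by apply/rungE; rewrite lx (lt_trans xl)// (half_expS n); lra.
move=> ilt /rungE; have [ilt'|ige] := ltnP i (size (tower n k)).
  rewrite level_right// => /andP[lx xl]; exists k, i; split=> //.
    by apply/rungE; rewrite (half_expS n); apply/andP; split; lra.
  by right.
have -> : i = (left_shift n k.+1 + (i - size (tower n k)))%N.
  by rewrite /= subnKC.
rewrite level_left// => /andP[lx xl].
exists k.+1, (i - size (tower n k))%N; split=> //.
- by move: ilt; rewrite towerSS// size_cat size_map -ltn_subLR.
- by apply/rungE; rewrite lx (lt_trans xl)// (half_expS n); lra.
- by left.
Qed.

(** Two rungs through a point have the same parent by induction, and the point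
    lies in only one of its halves. *)
Lemma rung_inj n k i k' i' x : (0 < n)%N ->
  (i < size (tower n k))%N -> (i' < size (tower n k'))%N ->
  rung n k i x -> rung n k' i' x -> k = k' /\ i = i'.
Proof.
move=> n0; elim: n n0 k i k' i' => [//|[_ _|n IH _]] k i k' i'.
  case: k => [|[|k]] //; case: k' => [|[|k']] //.
  - by case: i i' => [|//] [|//].
  - case: i i' => [|//] [|//] _ _ /rungE/andP[/= ? ?] /rungE/andP[/= ? ?].
    by exfalso; lra.
  - case: i i' => [|//] [|//] _ _ /rungE/andP[/= ? ?] /rungE/andP[/= ? ?].
    by exfalso; lra.
  - by case: i i' => [|//] [|//].
move=> ilt ilt' /(rung_parent _ ilt)[//|k0 [i0 [si0 r0 c0]]].
move=> /(rung_parent _ ilt')[//|k1 [i1 [si1 r1 c1]]].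
have [ek ei] := IH isT _ _ _ _ si0 si1 r0 r1; subst k1 i1.
by case: c0 c1 => -[h0 [-> ->]] [] [h1 [-> ->]] //; exfalso; lra.
Qed.

(** The halves of two consecutive rungs are consecutive at the next stage, at the
    same distance, so that a displacement defined at a stage never changes. *)
Lemma rung_child n k i x : (0 < n)%N -> (i.+1 < size (tower n k))%N ->
  rung n k i x -> exists k' i',
  [/\ (i'.+1 < size (tower n.+1 k'))%N, rung n.+1 k' i' x &
      level n.+1 k' i'.+1 - level n.+1 k' i' = level n k i.+1 - level n k i].
Proof.
move=> n0 ilt /rungE/andP[lx xl].
have [xlt|xge] := ltP x (level n k i + 2^-1 ^+ n.+1).
  exists k, (left_shift n k + i)%N; split.
  - by rewrite -addnS size_left.
  - by apply/rungE; rewrite level_left// lx.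
  - by rewrite -addnS !level_left.
exists k.+1, i; split; first by rewrite size_right.
  apply/rungE; rewrite level_right ?(ltnW ilt)// xge/=.
  by move: xl; rewrite (half_expS n) addrA.
by rewrite !level_right ?(ltnW ilt)//; lra.
Qed.

Lemma rung_descendant m n k i x : (0 < n)%N -> (i.+1 < size (tower n k))%N ->
  rung n k i x -> exists k' i',
  [/\ (i'.+1 < size (tower (m + n) k'))%N, rung (m + n) k' i' x &
      level (m + n) k' i'.+1 - level (m + n) k' i' = level n k i.+1 - level n k i].
Proof.
move=> n0 ilt rx; elim: m => [|m [k1 [i1 [s1 r1 d1]]]]; first by exists k, i.
have mn0 : (0 < m + n)%N by rewrite addn_gt0 n0 orbT.
have [k2 [i2 [s2 r2 d2]]] := rung_child mn0 s1 r1.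
by exists k2, i2; rewrite addSn; split=> //; rewrite d2.
Qed.

(** Two stages at which the image of a point is prescribed are compared at a
    common later stage, where the rung of the point is unique. *)
Lemma pascal_rung n k i x : (0 < n)%N -> (i.+1 < size (tower n k))%N ->
  rung n k i x -> pascal x = x - level n k i + level n k i.+1.
Proof.
move=> n0 ilt rx; apply: xget_unique => [|y] /=.
  exists n, k, i; split=> //; rewrite leqNgt; apply/negP => nk.
  by move: ilt; rewrite size_tower// bin_small.
move=> [n' [k' [i' [n'0 _ ilt' rx' ->]]]].
have [k1 [i1 [s1 r1 d1]]] := rung_descendant n' n0 ilt rx.
have [k2 [i2 [s2 r2 d2]]] := rung_descendant n n'0 ilt' rx'.
move: s2 r2 d2; rewrite addnC => s2 r2 d2.
have nn0 : (0 < n' + n)%N by rewrite addn_gt0 n0 orbT.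
have [ek ei] := rung_inj nn0 (ltnW s1) (ltnW s2) r1 r2; subst k2 i2.
by move: d2; rewrite d1; lra.
Qed.

Lemma iter_pascal n k j x : (0 < n)%N -> (j < size (tower n k))%N ->
  tower_basis n k x ->
  iter j pascal x = x - level n k 0 + level n k j /\ rung n k j (iter j pascal x).
Proof.
move=> n0 + bx; elim: j => [_|j IH jlt] /=; first by rewrite subrK.
have [-> rj] := IH (ltnW jlt).
have rj' : rung n k j (x - level n k 0 + level n k j) by have [<- ] := IH (ltnW jlt).
rewrite (pascal_rung n0 jlt rj').
have e : x - level n k 0 + level n k j - level n k j + level n k j.+1 =
  x - level n k 0 + level n k j.+1 by rewrite addrK.
split; first by rewrite e.
rewrite e; move/rungE: bx => /andP[? ?]; apply/rungE; apply/andP; split; lra.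
Qed.

Lemma tower_bounds n k a : (0 < n)%N -> a \in tower n k ->
  0 <= a /\ (a + 2^-1 ^+ n <= 2^-1 \/ 2^-1 <= a /\ a + 2^-1 ^+ n <= 1).
Proof.
elim: n k a => [//|[_|n IH]] k a _.
  case: k => [|[|k]] //; rewrite inE => /eqP ->; split; rewrite ?expr1; first by [].
  - by left; rewrite add0r.
  - by rewrite invr_ge0.
  - by right; split=> //; lra.
have hp := half_exp_gt0 n.+2.
have left b j : b \in tower n.+1 j ->
    0 <= b /\ (b + 2^-1 ^+ n.+2 <= 2^-1 \/ 2^-1 <= b /\ b + 2^-1 ^+ n.+2 <= 1).
  by move=> /IH[//|b0]; rewrite (half_expS n.+1) => -[?|[? ?]]; split=> //;
    [left|right; split]; lra.
case: k => [|k]; first by rewrite towerS0//; exact: left.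
rewrite towerSS// mem_cat => /orP[/mapP[b /IH[//|b0]]|]; last exact: left.
rewrite (half_expS n.+1) => b1 ->; split; first lra.
by case: b1 => [b1|[b1 b2]]; [left|right; split]; lra.
Qed.

(** Value of [g0] on a rung with left endpoint [a]. *)
Definition letter a : R := if a < 2^-1 then 1 else -1.

Lemma g0_rung n k i x : (0 < n)%N -> (i < size (tower n k))%N ->
  rung n k i x -> g0 x = letter (level n k i).
Proof.
move=> n0 ilt /rungE/andP[lx xl].
have [a0 a1] := tower_bounds n0 (mem_nth 0 ilt).
have hp := half_exp_gt0 n.
rewrite /g0 /letter /= !indicE.
case: a1 => [a1|[a1 a2]].
  have -> : (level n k i < 2^-1) by lra.
  rewrite mem_set; last by rewrite /= in_itv/=; apply/andP; split; lra.
  rewrite memNset ?subr0// /= in_itv/= => /andP[? ?]; lra.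
have -> : (level n k i < 2^-1) = false by apply/negbTE; rewrite -leNgt.
rewrite memNset; last by rewrite /= in_itv/= => /andP[? ?]; lra.
rewrite mem_set ?sub0r// /= in_itv/=; apply/andP; split; lra.
Qed.

End towers.

(** * Partial sums of words *)

Section words.
Context {R : realType}.
Implicit Types (w : seq R) (s t q : R) (i n k : nat).

Definition psum w i : R := \sum_(j < i) w`_j.

Definition lin_psum w t : R :=
  let j := Num.truncn t in
  (1 - (t - j%:R)) * psum w j + (t - j%:R) * psum w j.+1.

(** The graph of the partial sums, rescaled to [[0, 1]] and sheared so that it
    vanishes at both ends. *)
Definition dev w t : R :=
  lin_psum w (t * (size w)%:R) - t * psum w (size w).

Lemma lin_psum_nat w i : lin_psum w i%:R = psum w i.
Proof. by rewrite /lin_psum natrK; ring. Qed.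

Lemma psum_cat_l w1 w2 i : (i <= size w1)%N -> psum (w1 ++ w2) i = psum w1 i.
Proof.
move=> ile; apply: eq_bigr => j _.
by rewrite nth_cat (leq_trans (ltn_ord j) ile).
Qed.

Lemma psum_cat_r w1 w2 i :
  psum (w1 ++ w2) (size w1 + i) = psum w1 (size w1) + psum w2 i.
Proof.
rewrite /psum big_split_ord/=; congr (_ + _); apply: eq_bigr => j _.
  by rewrite nth_cat ltn_ord.
by rewrite nth_cat ltnNge leq_addr/= addKn.
Qed.

(** Two sequences of sums that agree up to [l] have the same interpolation up to
    [l]: at [l] itself the next sum is taken with weight zero. *)
Lemma interp_ext (f g : nat -> R) l t : 0 <= t <= l%:R ->
  (forall i, (i <= l)%N -> f i = g i) ->
  let j := Num.truncn t in
  (1 - (t - j%:R)) * f j + (t - j%:R) * f j.+1 =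
  (1 - (t - j%:R)) * g j + (t - j%:R) * g j.+1.
Proof.
move=> /andP[t0 tl] fg /=.
have jt : (Num.truncn t)%:R <= t by rewrite truncn_le.
have jl : (Num.truncn t <= l)%N by rewrite -(ler_nat R) (le_trans jt).
rewrite fg//; have [jl'|lj] := ltnP (Num.truncn t) l; first by rewrite fg.
have -> : t - (Num.truncn t)%:R = 0; last by rewrite !mul0r.
apply/eqP; rewrite subr_eq0 eq_le jt andbT (le_trans tl)// ler_nat//.
Qed.

Lemma lin_psum_cat_l w1 w2 t : 0 <= t <= (size w1)%:R ->
  lin_psum (w1 ++ w2) t = lin_psum w1 t.
Proof. by move=> ht; apply: (interp_ext ht) => i; exact: psum_cat_l. Qed.

Lemma lin_psum_cat_r w1 w2 t : 0 <= t ->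
  lin_psum (w1 ++ w2) ((size w1)%:R + t) = psum w1 (size w1) + lin_psum w2 t.
Proof.
move=> t0; rewrite /lin_psum.
rewrite truncnD ?natr_nat// natrK -addnS !psum_cat_r natrD; ring.
Qed.

(** Height of the corner at [q = size w1 / size (w1 ++ w2)], where the two
    sheared graphs are glued. *)
Definition corner w1 w2 : R :=
  psum w1 (size w1) - (size w1)%:R / (size (w1 ++ w2))%:R *
    psum (w1 ++ w2) (size (w1 ++ w2)).

Lemma dev_cat_l w1 w2 s : 0 <= s <= 1 -> (0 < size w1)%N ->
  dev (w1 ++ w2) ((size w1)%:R / (size (w1 ++ w2))%:R * s) =
  dev w1 s + corner w1 w2 * s.
Proof.
move=> /andP[s0 s1] l1.
have sz : (size (w1 ++ w2))%:R != 0 :> R.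
  by rewrite pnatr_eq0 size_cat -lt0n ltn_addr.
rewrite /dev /corner.
have -> : (size w1)%:R / (size (w1 ++ w2))%:R * s * (size (w1 ++ w2))%:R =
  s * (size w1)%:R :> R by field.
rewrite lin_psum_cat_l; last by rewrite mulr_ge0//= ler_piMl.
ring.
Qed.

Lemma dev_cat_r w1 w2 s : 0 <= s <= 1 -> (0 < size w2)%N ->
  let q := (size w1)%:R / (size (w1 ++ w2))%:R in
  dev (w1 ++ w2) (q + (1 - q) * s) = dev w2 s + corner w1 w2 * (1 - s).
Proof.
move=> /andP[s0 s1] l2 q.
have sz : (size (w1 ++ w2))%:R != 0 :> R.
  by rewrite pnatr_eq0 size_cat -lt0n ltn_addl.
have -> : dev (w1 ++ w2) (q + (1 - q) * s) =
    psum w1 (size w1) + lin_psum w2 (s * (size w2)%:R) -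
    (q + (1 - q) * s) * psum (w1 ++ w2) (size (w1 ++ w2)).
  rewrite /dev -lin_psum_cat_r; last by rewrite mulr_ge0.
  congr (lin_psum _ _ - _); rewrite /q.
  by rewrite size_cat natrD in sz *; field.
rewrite /dev /corner -/q.
have -> : psum (w1 ++ w2) (size (w1 ++ w2)) =
    psum w1 (size w1) + psum w2 (size w2) by rewrite size_cat psum_cat_r.
ring.
Qed.

Lemma psum_le w i : (forall a, a \in w -> `|a| <= 1) ->
  `|psum w i| <= (size w)%:R.
Proof.
move=> w1; have [il|li] := leqP i (size w).
  apply: (le_trans (ler_norm_sum _ _ _)).
  apply: (@le_trans _ _ (\sum_(j < i) 1)).
    by apply: ler_sum => j _; rewrite w1// mem_nth// (leq_trans (ltn_ord j)).
  by rewrite sumr_const card_ord ler_nat.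
rewrite -(subnKC (ltnW li)) -[in psum w](cats0 w) psum_cat_r.
rewrite [X in _ + X]big1 ?addr0; last by move=> j _; rewrite nth_nil.
apply: (le_trans (ler_norm_sum _ _ _)).
apply: (@le_trans _ _ (\sum_(j < size w) 1)).
  by apply: ler_sum => j _; rewrite w1// mem_nth.
by rewrite sumr_const card_ord.
Qed.

Lemma dev_le w t : (forall a, a \in w -> `|a| <= 1) -> 0 <= t <= 1 ->
  `|dev w t| <= 2 * (size w)%:R.
Proof.
move=> w1 /andP[t0 t1].
have hp i : - (size w)%:R <= psum w i <= (size w)%:R by rewrite -ler_norml psum_le.
have T0 : 0 <= t * (size w)%:R by rewrite mulr_ge0.
have /andP[jt tj] := truncn_itv T0.
rewrite /dev /lin_psum; set T := t * _ in T0 jt tj *.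
set j := Num.truncn T in jt tj *; set u := T - j%:R.
have u0 : 0 <= u by rewrite subr_ge0.
have u1 : u <= 1 by rewrite /u lerBlDl natr1 ltW.
have := hp j; have := hp j.+1; have := hp (size w).
move: (psum w j) (psum w j.+1) (psum w (size w)) (size w)%:R => a b c L.
move=> /andP[? ?] /andP[? ?] /andP[? ?].
rewrite ler_norml; apply/andP; split; nra.
Qed.

End words.

(** * The words of the towers *)

Section tower_words.
Context {R : realType}.
Implicit Types (x s t : R) (n k : nat).

Local Arguments Defs.tower : simpl never.

Definition word n k : seq R := [seq letter a | a <- tower n k].

Lemma size_word n k : (0 < n)%N -> size (word n k) = 'C(n, k).
Proof. by move=> n0; rewrite size_map size_tower. Qed.

Lemma wordS0 n : (0 < n)%N -> word n.+1 0 = word n 0.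
Proof. by move=> n0; rewrite /word towerS0. Qed.

(** Taking the right halves of the rungs keeps all letters: a rung lies on one
    side of 1/2, and so do both of its halves. *)
Lemma wordSS n k : (0 < n)%N -> word n.+1 k.+1 = word n k ++ word n k.+1.
Proof.
move=> n0; rewrite /word towerSS// map_cat -map_comp; congr (_ ++ _).
apply/eq_in_map => a /(tower_bounds n0)[a0 a1] /=; rewrite /letter.
have hp : 0 < (2^-1 ^+ n.+1 : R) by exact: half_exp_gt0.
move: a1; rewrite (half_expS n) => -[a1|[a1 a2]].
  have -> : a + 2^-1 ^+ n.+1 < 2^-1 by lra.
  by have -> : a < 2^-1 by lra.
have -> : (a < 2^-1) = false by apply/negbTE; rewrite -leNgt.
by have -> : (a + 2^-1 ^+ n.+1 < 2^-1) = false by apply/negbTE; rewrite -leNgt; lra.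
Qed.

Lemma word_le1 n k a : a \in word n k -> `|a| <= 1.
Proof. by case/mapP => b _ ->; rewrite /letter; case: ifP; rewrite ?normrN normr1. Qed.

Lemma bin_mull n k : (0 < n)%N ->
  'C(n, k)%:R = 'C(n.+1, k.+1)%:R * k.+1%:R / n.+1%:R :> R.
Proof.
move=> n0; rewrite -[X in X / _]natrM mulnC -mul_bin_diag natrM.
by rewrite mulrAC divff ?mul1r// pnatr_eq0.
Qed.

Lemma bin_mulr n k : (k <= n)%N ->
  'C(n, k.+1)%:R = 'C(n.+1, k.+1)%:R * (n%:R - k%:R) / n.+1%:R :> R.
Proof.
move=> kn; have := mul_bin_left n k; have := mul_bin_diag n.+1 k.
move=> /(congr1 (fun m => m%:R : R)) + /(congr1 (fun m => m%:R : R)).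
rewrite !natrM natrB// => e1 e2.
have k0 : (k.+1%:R : R) != 0 by rewrite pnatr_eq0.
have n0 : (n.+1%:R : R) != 0 by rewrite pnatr_eq0.
apply: (mulfI k0); rewrite e2; apply: (mulfI n0).
rewrite [LHS]mulrCA e1; field.
by rewrite -natr1 in n0.
Qed.

Lemma psum_word n k : (0 < n)%N -> (k <= n)%N ->
  psum (word n k) (size (word n k)) =
  'C(n, k)%:R * (n%:R - 2 * k%:R) / n%:R.
Proof.
elim: n k => [//|[_|n IH]] k _ kn.
  case: k kn => [|[|k]] // _; rewrite /psum /word /letter /= big_ord_recr big_ord0/=.
    by rewrite invr_gt0 ltr0n/= bin0; field.
  by rewrite ltxx /= binn; field.
have n1 : (n.+1%:R : R) != 0 by rewrite pnatr_eq0.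
have n2 : (n.+2%:R : R) != 0 by rewrite pnatr_eq0.
case: k kn => [|k] kn.
  by rewrite wordS0// IH// !bin0 !mulr0 !subr0 !mul1r !divff.
rewrite wordSS// size_cat psum_cat_r IH//.
have -> : psum (word n.+1 k.+1) (size (word n.+1 k.+1)) =
   'C(n.+1, k.+1)%:R * (n.+1%:R - 2 * k.+1%:R) / n.+1%:R.
  move: kn; rewrite leq_eqVlt => /orP[|kn]; last by rewrite IH.
  rewrite eqSS => /eqP ->; rewrite size_word// bin_small//.
  by rewrite /psum big_ord0 !mul0r.
rewrite (bin_mull k (ltn0Sn n)) (@bin_mulr n.+1 k)//.
move: n1 n2; rewrite -(natr1 n.+1) -(natr1 k) => n1 n2.
by field; rewrite !nat1r n1 n2.
Qed.

(** For [0 < k < n] this is [2 * 'C(n - 2, k - 1) / n]; the form chosen has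
    rational ratios between neighbouring indices. *)
Definition kink n k : R :=
  2 * 'C(n, k)%:R * k%:R * (n%:R - k%:R) / (n%:R ^+ 2 * (n%:R - 1)).

Lemma corner_word n k : (0 < n)%N -> (k < n)%N ->
  corner (word n k) (word n k.+1) = kink n.+1 k.+1.
Proof.
move=> n0 kn; rewrite /corner -wordSS// !psum_word ?(ltnW kn)// ?size_word//; last exact: ltnW.
rewrite /kink (bin_mull k n0).
have c0 : ('C(n.+1, k.+1)%:R : R) != 0.
  by rewrite pnatr_eq0 -lt0n bin_gt0 ltnW.
have n1 : (n%:R : R) != 0 by rewrite pnatr_eq0 -lt0n.
have n2 : (n.+1%:R : R) != 0 by rewrite pnatr_eq0.
move: c0 n2; rewrite -(natr1 n) -(natr1 k) => c0 n2.
by field; rewrite addrK c0 n1 n2.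
Qed.

Lemma kink_gt0 n k : (0 < k < n)%N -> 0 < kink n k.
Proof.
move=> /andP[k0 kn]; have n1 : (1 < n)%N by exact: leq_ltn_trans kn.
rewrite /kink divr_gt0//.
  by rewrite !mulr_gt0 ?ltr0n ?bin_gt0 ?subr_gt0 ?ltr_nat// ltnW.
by rewrite mulr_gt0 ?exprn_gt0 ?ltr0n ?subr_gt0 ?ltr1n// ltnW.
Qed.

Lemma dev_wordL n k s : (0 < n)%N -> (k < n)%N -> 0 <= s <= 1 ->
  dev (word n.+1 k.+1) (k.+1%:R / n.+1%:R * s) =
  dev (word n k) s + kink n.+1 k.+1 * s.
Proof.
move=> n0 kn s01; rewrite -corner_word// wordSS// -dev_cat_l//; last first.
  by rewrite size_word// bin_gt0 ltnW.
congr (dev _ (_ * _)); rewrite -wordSS// !size_word// (bin_mull _ n0).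
field; rewrite -[1 + n%:R]/(1%:R + n%:R) -natrD !pnatr_eq0 /=.
by rewrite -lt0n bin_gt0 ltnW.
Qed.

Lemma dev_wordR n k s : (0 < n)%N -> (k < n)%N -> 0 <= s <= 1 ->
  let q := k.+1%:R / n.+1%:R in
  dev (word n.+1 k.+1) (q + (1 - q) * s) =
  dev (word n k.+1) s + kink n.+1 k.+1 * (1 - s).
Proof.
move=> n0 kn s01 q; rewrite -corner_word// wordSS// -dev_cat_r//; last first.
  by rewrite size_word// bin_gt0.
have -> // : q = (size (word n k))%:R / (size (word n k ++ word n k.+1))%:R.
rewrite /q -wordSS// !size_word// (bin_mull _ n0).
field; rewrite -[1 + n%:R]/(1%:R + n%:R) -natrD !pnatr_eq0 /=.
by rewrite -lt0n bin_gt0 ltnW.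
Qed.

Lemma birkhoff_sum_word n k i x : (0 < n)%N -> (i <= 'C(n, k))%N ->
  tower_basis n k x -> birkhoff_sum g0 x i = psum (word n k) i.
Proof.
move=> n0 il bx; apply: eq_bigr => j _.
have jl : (j < size (tower n k : seq R))%N.
  by rewrite size_tower// (leq_trans (ltn_ord j)).
have [_ rj] := iter_pascal n0 jl bx.
by rewrite (g0_rung n0 jl rj) (nth_map 0).
Qed.

Lemma bridge_word n k t x : (0 < n)%N -> tower_basis n k x -> 0 <= t <= 1 ->
  bridge g0 x 'C(n, k) t = dev (word n k) t.
Proof.
move=> n0 bx /andP[t0 t1]; rewrite /bridge /dev size_word//.
have ext u : 0 <= u <= 'C(n, k)%:R -> interp_sum g0 x u = lin_psum (word n k) u.
  by move=> hu; apply: (interp_ext hu) => i il; exact: birkhoff_sum_word.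
rewrite !ext ?lin_psum_nat// ?ler0n ?lexx//.
by rewrite mulr_ge0//= ler_piMl.
Qed.

End tower_words.

(** * The limit curve *)

Section limit_curve.
Context {R : realType}.
Variables (p : R) (p_gt0 : 0 < p) (p_lt1 : p < 1).
Implicit Types (s t x y e : R) (f : R -> R) (i j : nat).

(** Contraction ratio of the two maps. *)
Definition ctr_ratio : R := Num.max p (1 - p).

Definition tent t : R := Num.max 0 (Num.min (t / p) ((1 - t) / (1 - p))).

(** The transfer operator whose fixed point is the limit curve.  The arguments
    of [f] leave [[0, 1]] for at most one of the two terms at a time, so that
    for [f] vanishing off [[0, 1]] this is a gluing without case distinction. *)
Definition glue f t : R :=
  p * f (t / p) + (1 - p) * f ((t - p) / (1 - p)) + tent t.

Definition approx j : R -> R := iter j glue (fun=> 0).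

(** The approximations increase, which makes their limit a supremum. *)
Definition limit t : R := sup (range (approx ^~ t)).

Let q_gt0 : 0 < 1 - p. Proof. by rewrite subr_gt0. Qed.
Let p_neq0 : p != 0. Proof. by rewrite gt_eqF. Qed.
Let q_neq0 : 1 - p != 0. Proof. by rewrite gt_eqF. Qed.

Lemma ctr_ratio_lt1 : ctr_ratio < 1.
Proof. by rewrite /ctr_ratio gt_max p_lt1/= gtrBl. Qed.

Lemma le_ctr_ratio : p <= ctr_ratio /\ 1 - p <= ctr_ratio.
Proof. by rewrite /ctr_ratio !le_max !lexx orbT. Qed.

Lemma ctr_ratio_gt0 : 0 < ctr_ratio.
Proof. by rewrite lt_max p_gt0. Qed.

(** A quantity that is dominated by every power of the contraction ratio
    vanishes; all identities and uniqueness statements below are obtained so. *)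
Lemma contracted_eq0 x c : (forall j, `|x| <= c * ctr_ratio ^+ j) -> x = 0.
Proof.
move=> xc; have cv : c * ctr_ratio ^+ n @[n --> \oo] --> c * 0.
  by apply: cvgMl_tmp; apply: cvg_expr; rewrite gtr0_norm ?ctr_ratio_gt0// ctr_ratio_lt1.
apply/normr0_eq0/eqP; rewrite eq_le normr_ge0 andbT -[leRHS](mulr0 c).
rewrite -(cvg_lim _ cv)//; apply: limr_ge; first exact/cvgP/cv.
exact: nearW.
Qed.

Lemma ctr_ratio_exp_lt e : 0 < e -> exists j, ctr_ratio ^+ j < e.
Proof.
move=> e0; apply: contrapT => h.
have : (e : R) = 0.
  apply: (@contracted_eq0 _ 1) => j; rewrite mul1r gtr0_norm// leNgt.
  by apply/negP => ?; apply: h; exists j.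
by move=> ez; rewrite ez ltxx in e0.
Qed.

Lemma unit_cover t : 0 <= t <= 1 -> exists2 s, 0 <= s <= 1 &
  t = p * s \/ t = p + (1 - p) * s.
Proof.
have [p0 p1] := (p_gt0, p_lt1).
move=> /andP[t0 t1]; have [tp|pt] := leP t p.
  exists (t / p); first by rewrite divr_ge0 ?(ltW p_gt0)//= ler_pdivrMr// mul1r.
  by left; field.
exists ((t - p) / (1 - p)); last by right; field.
by rewrite divr_ge0 ?subr_ge0 ?(ltW pt) ?(ltW p_lt1)//= ler_pdivrMr// mul1r lerB.
Qed.

Lemma tentL s : 0 <= s <= 1 -> tent (p * s) = s.
Proof.
have [p0 p1] := (p_gt0, p_lt1).
move=> /andP[s0 s1]; rewrite /tent.
have -> : p * s / p = s by field.
rewrite min_l ?max_r// ler_pdivlMr//.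
by nra.
Qed.

Lemma tentR s : 0 <= s <= 1 -> tent (p + (1 - p) * s) = 1 - s.
Proof.
have [p0 p1] := (p_gt0, p_lt1).
move=> /andP[s0 s1]; rewrite /tent.
have -> : (1 - (p + (1 - p) * s)) / (1 - p) = 1 - s by field.
rewrite min_r ?max_r// ?subr_ge0// ler_pdivlMr//.
by nra.
Qed.

Definition vanishing f := forall t, t <= 0 \/ 1 <= t -> f t = 0.

Lemma tent_vanishing : vanishing tent.
Proof.
move=> t [t0|t1]; rewrite /tent max_l// ge_min.
  by rewrite ler_pdivrMr// mul0r t0.
by rewrite [X in _ || X]ler_pdivrMr// mul0r subr_le0 t1 orbT.
Qed.

Lemma glue_vanishing f : vanishing f -> vanishing (glue f).
Proof.
have [p0 p1] := (p_gt0, p_lt1).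
move=> f0 t ht; rewrite /glue tent_vanishing//.
have -> : f (t / p) = 0.
  apply: f0; case: ht => [t0|t1]; [left|right].
    by rewrite ler_pdivrMr// mul0r.
  by rewrite ler_pdivlMr// mul1r; lra.
have -> : f ((t - p) / (1 - p)) = 0.
  apply: f0; case: ht => [t0|t1]; [left|right].
    by rewrite ler_pdivrMr// mul0r; lra.
  by rewrite ler_pdivlMr// mul1r; lra.
by rewrite !mulr0 !addr0.
Qed.

Lemma glueL f s : vanishing f -> 0 <= s <= 1 -> glue f (p * s) = p * f s + s.
Proof.
have [p0 p1] := (p_gt0, p_lt1).
move=> f0 s01; rewrite /glue tentL//; have -> : p * s / p = s by field.
rewrite [X in (1 - p) * X]f0 ?mulr0 ?addr0//; left.
by rewrite ler_pdivrMr// mul0r; move: s01 => /andP[? ?]; nra.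
Qed.

Lemma glueR f s : vanishing f -> 0 <= s <= 1 ->
  glue f (p + (1 - p) * s) = (1 - p) * f s + (1 - s).
Proof.
have [p0 p1] := (p_gt0, p_lt1).
move=> f0 s01; rewrite /glue tentR//.
have -> : (p + (1 - p) * s - p) / (1 - p) = s by field.
rewrite [X in p * X]f0 ?mulr0 ?add0r//; right.
by rewrite ler_pdivlMr// mul1r; move: s01 => /andP[? ?]; nra.
Qed.

Lemma approx_vanishing j : vanishing (approx j).
Proof. by elim: j => [//|j IH]; exact: glue_vanishing. Qed.

Lemma approx_step j t : 0 <= approx j.+1 t - approx j t <= ctr_ratio ^+ j.
Proof.
have [p0 p1] := (p_gt0, p_lt1).
have rj i : 0 <= ctr_ratio ^+ i by rewrite exprn_ge0// ltW// ctr_ratio_gt0.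
have [t01|t01] := boolP (0 <= t <= 1); last first.
  have ht : t <= 0 \/ 1 <= t.
    by move: t01; rewrite negb_and -!ltNge => /orP[/ltW|/ltW]; [left|right].
  by rewrite !approx_vanishing// subrr lexx rj.
elim: j t t01 => [|j IH] t t01.
  have [s /andP[s0 s1] [->|->]] := unit_cover t01.
    by rewrite /approx /= glueL ?s0// expr0; apply/andP; split; lra.
  by rewrite /approx /= glueR ?s0// expr0; apply/andP; split; lra.
have [pr qr] := le_ctr_ratio; have rj0 := rj j.
have [s s01 [->|->]] := unit_cover t01; have /andP[h1 h2] := IH _ s01.
  have e k : approx k.+1 (p * s) = p * approx k s + s.
    by rewrite [LHS]glueL//; exact: approx_vanishing.
  by rewrite !e exprS; apply/andP; split; nra.
have e k : approx k.+1 (p + (1 - p) * s) = (1 - p) * approx k s + (1 - s).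
  by rewrite [LHS]glueR//; exact: approx_vanishing.
by rewrite !e exprS; apply/andP; split; nra.
Qed.

Let tail j := ctr_ratio ^+ j / (1 - ctr_ratio).

Lemma tail_ge0 j : 0 <= tail j.
Proof.
by rewrite /tail divr_ge0 ?exprn_ge0 ?(ltW ctr_ratio_gt0)// subr_ge0 ltW// ctr_ratio_lt1.
Qed.

Lemma approx_le i j t : approx i t <= approx j t + tail j.
Proof.
have inc : {homo approx ^~ t : a b / (a <= b)%N >-> a <= b}.
  apply: homo_leq => [x //|y x z|n]; first exact: le_trans.
  by have /andP[+ _] := approx_step n t; rewrite subr_ge0.
have dec : {homo (fun k => approx k t + tail k) : a b / (a <= b)%N >-> b <= a}.
  apply: (@homo_leq R _ (fun x y => y <= x)) => [x //|y x z xy yz|n].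
    exact: le_trans yz xy.
  have /andP[_ h] := approx_step n t.
  suff -> : tail n = tail n.+1 + ctr_ratio ^+ n by lra.
  rewrite /tail exprS; field; rewrite subr_eq0 eq_sym lt_eqF//.
  exact: ctr_ratio_lt1.
apply: (le_trans (inc _ _ (leq_maxl i j))).
apply: (le_trans _ (dec _ _ (leq_maxr i j))).
by rewrite lerDl tail_ge0.
Qed.

Lemma limit_approx j t : approx j t <= limit t <= approx j t + tail j.
Proof.
have ub k : ubound (range (approx ^~ t)) (approx k t + tail k).
  by move=> _ [i _ <-]; exact: approx_le.
apply/andP; split.
  by apply: ub_le_sup; [exists (approx 0 t + tail 0); exact: ub | exists j].
by apply: ge_sup => //; exists (approx 0 t); exists 0%N.
Qed.

Lemma limit_vanishing : vanishing limit.
Proof.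
move=> t ht; rewrite /limit.
have -> : range (approx ^~ t) = [set 0]; last by rewrite sup1.
by rewrite eqEsubset; split=> [_ [j _ <-]|_ ->] /=;
  [|exists 0%N => //]; rewrite approx_vanishing.
Qed.

(** Both functional equations pass to the limit from [approx]. *)
Lemma limit_glue c (u v : R) d : 0 < c -> c <= 1 ->
  (forall j, approx j.+1 u = c * approx j v + d) -> limit u = c * limit v + d.
Proof.
move=> c0 c1 h; apply/eqP; rewrite -subr_eq0; apply/eqP.
apply: (@contracted_eq0 _ (2 / (1 - ctr_ratio))) => j.
have -> : 2 / (1 - ctr_ratio) * ctr_ratio ^+ j = 2 * tail j by rewrite /tail; ring.
have /andP[a1 a2] := limit_approx j.+1 u; have /andP[b1 b2] := limit_approx j v.
have t1 : tail j.+1 <= tail j.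
  rewrite /tail ler_pdivrMr ?subr_gt0 ?ctr_ratio_lt1// divfK; last first.
    by rewrite subr_eq0 gt_eqF// ctr_ratio_lt1.
  by rewrite exprS ler_piMl ?exprn_ge0// ltW// ?ctr_ratio_gt0// ctr_ratio_lt1.
have t0 := tail_ge0 j; rewrite h in a1 a2.
rewrite ler_norml; apply/andP; split; nra.
Qed.

Lemma limitL s : 0 <= s <= 1 -> limit (p * s) = p * limit s + s.
Proof.
move=> s01; apply: limit_glue => // [|j]; first exact: ltW.
by rewrite [LHS]glueL//; exact: approx_vanishing.
Qed.

Lemma limitR s : 0 <= s <= 1 ->
  limit (p + (1 - p) * s) = (1 - p) * limit s + (1 - s).
Proof.
move=> s01; apply: limit_glue => // [|j]; first by rewrite gerBl ltW.
by rewrite [LHS]glueR//; exact: approx_vanishing.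
Qed.

Lemma limit_p : limit p = 1.
Proof.
have := @limitL 1; rewrite ler01 lexx mulr1 => -> //.
by rewrite (limit_vanishing (or_intror (lexx 1))) mulr0 add0r.
Qed.

Lemma limit_ge0 t : 0 <= limit t.
Proof. by have /andP[] := limit_approx 0 t. Qed.

Lemma limit_le t : limit t <= (1 - ctr_ratio)^-1.
Proof.
by have /andP[_] := limit_approx 0 t; rewrite /tail expr0 mul1r /approx/= add0r.
Qed.

Definition lipschitz_on_line f := exists L, forall s t, f s - f t <= L * `|s - t|.

Lemma tent_lipschitz : lipschitz_on_line tent.
Proof.
exists (p^-1 + (1 - p)^-1) => s t; rewrite /tent.
have hc : 0 < p^-1 by rewrite invr_gt0.
have hd : 0 < (1 - p)^-1 by rewrite invr_gt0.
set c := p^-1 in hc *; set d := (1 - p)^-1 in hd *.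
have h1 : s - t <= `|s - t| by exact: ler_norm.
have h2 : t - s <= `|s - t| by rewrite distrC; exact: ler_norm.
have u1 : s * c - t * c <= c * `|s - t| by nra.
have u2 : (1 - s) * d - (1 - t) * d <= d * `|s - t| by nra.
have n1 : 0 <= c * `|s - t| by rewrite mulr_ge0// ltW.
have n2 : 0 <= d * `|s - t| by rewrite mulr_ge0// ltW.
rewrite [leRHS]mulrDl; move: u1 u2 n1 n2.
move: (s * c) (t * c) ((1 - s) * d) ((1 - t) * d) (c * _) (d * _) => a b a' b' x y.
move=> ? ? ? ?; rewrite lerBlDr ge_max; apply/andP; split.
  have : 0 <= Num.max 0 (Num.min b b') by rewrite le_max lexx.
  by move: (Num.max _ _) => m; lra.
rewrite ge_min; have [bb|bb] := leP b b'; apply/orP; [left|right].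
  have : b <= Num.max 0 b by rewrite le_max lexx orbT.
  lra.
have : b' <= Num.max 0 b' by rewrite le_max lexx orbT.
lra.
Qed.

Lemma approx_lipschitz j : lipschitz_on_line (approx j).
Proof.
elim: j => [|j [L IH]].
  by exists 0 => s t; rewrite /approx/= subrr mul0r.
have [K hK] := tent_lipschitz.
exists (2 * L + K) => s t; rewrite /approx/= -/(approx j) /glue.
have i1 := IH (s / p) (t / p).
have i2 := IH ((s - p) / (1 - p)) ((t - p) / (1 - p)).
have i3 := hK s t.
have e1 : p * `|s / p - t / p| = `|s - t|.
  by rewrite -{1}(gtr0_norm p_gt0) -normrM; congr (`|_|); field.
have e2 : (1 - p) * `|(s - p) / (1 - p) - (t - p) / (1 - p)| = `|s - t|.
  by rewrite -{1}(gtr0_norm q_gt0) -normrM; congr (`|_|); field.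
have j1 : p * (approx j (s / p) - approx j (t / p)) <= L * `|s - t|.
  by rewrite -e1 mulrCA ler_pM2l.
have j2 : (1 - p) * (approx j ((s - p) / (1 - p)) - approx j ((t - p) / (1 - p)))
    <= L * `|s - t|.
  by rewrite -e2 mulrCA ler_pM2l.
move: j1 j2 i3; rewrite !mulrBr !mulrDl; lra.
Qed.

(** A uniform limit of Lipschitz functions is uniformly continuous, although the
    Lipschitz constants of the approximations are unbounded. *)
Lemma limit_unif_continuous e : 0 < e ->
  exists2 d, 0 < d & forall s t, `|s - t| <= d -> `|limit s - limit t| <= e.
Proof.
move=> e0; have r1 : 0 < 1 - ctr_ratio by rewrite subr_gt0 ctr_ratio_lt1.
have [j hj] := @ctr_ratio_exp_lt (e / 2 * (1 - ctr_ratio))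
  (mulr_gt0 (divr_gt0 e0 (ltr0Sn _ _)) r1).
have hj' : tail j <= e / 2 by rewrite /tail ler_pdivrMr// ltW.
have [L hL] := approx_lipschitz j.
have L1 : 0 < `|L| + 1 by rewrite ltr_wpDl.
exists (e / 2 / (`|L| + 1)); first by rewrite !divr_gt0.
have main s t : `|s - t| <= e / 2 / (`|L| + 1) -> limit s - limit t <= e.
  rewrite ler_pdivlMr// => st.
  have /andP[_ a] := limit_approx j s; have /andP[b _] := limit_approx j t.
  have c := hL s t; have n0 := normr_ge0 (s - t); have := ler_norm L.
  move: st; move: `|s - t| n0 `|L| c => D ? K ? ? ?.
  nra.
move=> s t st; rewrite ler_norml main// andbT.
by rewrite lerNl opprB main// distrC.
Qed.

Lemma limit_continuous : continuous limit.
Proof.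
move=> t; apply/cvgrPdist_le => e e0; have [d d0 hd] := limit_unif_continuous e0.
near=> s; apply: hd; near: s; rewrite near_simpl.
exact: cvgr_dist_le.
Unshelve. all: by end_near. Qed.

Definition limit_graph : set (R * R) :=
  (fun t => (t, limit t)) @` `[0, 1]%classic.

Let in01 t : (t \in `[0, 1]) = (0 <= t <= 1). Proof. by rewrite in_itv. Qed.

Lemma limit_graph_invariant : invariant_compact p limit_graph.
Proof.
have [p0 p1] := (p_gt0, p_lt1).
split.
- by move=> _ [t t01 <-]; split.
- by exists (0, limit 0); exists 0 => //=; rewrite in_itv/= lexx ler01.
- apply: continuous_compact; last exact: segment_compact.
  apply: continuous_subspaceT => t.
  exact: (cvg_pair cvg_id (@limit_continuous _)).
rewrite eqEsubset; split=> z.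
  move=> [t /=]; rewrite in_itv/= => t01 <-.
  have [s s01 [->|->]] := unit_cover t01; [left|right];
    exists (s, limit s); rewrite /= ?/alphaL ?/alphaR /=.
  - by exists s => //=; rewrite in_itv.
  - by rewrite limitL.
  - by exists s => //=; rewrite in_itv.
  - by rewrite limitR//; congr (_, _); ring.
case=> -[_ [s /= + <-] <-]; rewrite in_itv/= => /andP[s0 s1].
  rewrite /alphaL/= -limitL ?s0//; exists (p * s) => //=.
  by rewrite in_itv/= mulr_ge0 ?(ltW p_gt0)//= mulr_ile1// ltW.
rewrite /alphaR/=; exists (p + (1 - p) * s) => /=.
  by rewrite in_itv/=; apply/andP; split; nra.
by rewrite limitR ?s0//; congr (_, _); ring.
Qed.

(** Vertical distance to the limit curve is contracted by both maps, hence zero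
    on a bounded invariant set. *)
Lemma invariant_sub_graph E : invariant_compact p E ->
  forall z, E z -> z.2 = limit z.1.
Proof.
move=> [E01 _ /compact_bounded[B [_ hB]] EE] z Ez.
have {}hB x y : E (x, y) -> `|y| <= `|B| + 1.
  move=> Exy; apply: le_trans (hB (`|B| + 1) _ _ Exy).
    by rewrite prod_normE/= le_max lexx orbT.
  by rewrite (le_lt_trans (ler_norm B))// ltrDl.
apply/eqP; rewrite -subr_eq0; apply/eqP.
apply: (@contracted_eq0 _ (`|B| + 1 + (1 - ctr_ratio)^-1)) => j.
elim: j z Ez => [|j IH] z Ez.
  rewrite expr0 mulr1; apply: (le_trans (ler_normB _ _)); apply: lerD.
    by case: z Ez => x y; exact: hB.
  by rewrite ger0_norm ?limit_le// limit_ge0.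
have [pr qr] := le_ctr_ratio; move: Ez; rewrite [in X in X -> _]EE => -[] [w Ew <-];
  have [+ _] := E01 _ Ew; rewrite /= in_itv/= => w01; rewrite exprS mulrCA.
- rewrite limitL//.
  have -> : p * w.2 + w.1 - (p * limit w.1 + w.1) = p * (w.2 - limit w.1) by ring.
  by rewrite normrM (gtr0_norm p_gt0) ler_pM// ?(ltW p_gt0)// IH.
- rewrite [_ + p]addrC limitR//.
  have -> : (1 - p) * w.2 - w.1 + 1 - ((1 - p) * limit w.1 + (1 - w.1)) =
    (1 - p) * (w.2 - limit w.1) by ring.
  by rewrite normrM (gtr0_norm q_gt0) ler_pM// ?(ltW q_gt0)// IH.
Qed.

(** The projection of an invariant set to [[0, 1]] is dense, because the images
    of any one of its points under words in the two maps are. *)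
Lemma invariant_dense E : invariant_compact p E -> forall j t, 0 <= t <= 1 ->
  exists2 z, E z & `|t - z.1| <= ctr_ratio ^+ j.
Proof.
move=> [E01 [z Ez] _ EE] j; elim: j => [|j IH] t t01.
  exists z => //; have [+ _] := E01 _ Ez; rewrite /= in_itv/= => /andP[? ?].
  by move: t01 => /andP[? ?]; rewrite expr0 ler_norml; apply/andP; split; lra.
have [pr qr] := le_ctr_ratio.
have [s s01 [->|->]] := unit_cover t01; have [w Ew hw] := IH _ s01.
  exists (alphaL p w); first by rewrite EE; left; exists w.
  by rewrite /= -mulrBr normrM (gtr0_norm p_gt0) exprS ler_pM// ltW.
exists (alphaR p w); first by rewrite EE; right; exists w.
rewrite /=; have -> : p + (1 - p) * s - ((1 - p) * w.1 + p) = (1 - p) * (s - w.1).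
  by ring.
by rewrite normrM (gtr0_norm q_gt0) exprS ler_pM// ltW.
Qed.

Lemma invariant_unique E : invariant_compact p E -> E = limit_graph.
Proof.
move=> iE; have sub := invariant_sub_graph iE.
have [E01 _ cE _] := iE; rewrite eqEsubset; split=> [[x y] Exy|_ [t /= + <-]].
  exists x; first by have [] := E01 _ Exy.
  by rewrite -(sub _ Exy).
rewrite in_itv/= => t01.
have : closed ((fun t => (t, limit t)) @^-1` E).
  apply: preimage_closed => [u _|]; last exact: compact_closed.
  exact: (cvg_pair cvg_id (@limit_continuous _)).
move=> /closure_id; set P := (X in X = _) => Pcl.
suff : closure P t by rewrite -Pcl.
move=> U /nbhs_ballP[e /= e0 tU].
have [j hj] := ctr_ratio_exp_lt e0.
have [[x y] Exy hx] := invariant_dense iE j t01.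
exists x; split; last by apply: tU; exact: le_lt_trans hj.
by rewrite /P /= -(sub _ Exy).
Qed.

Lemma calM_limit t : 0 <= t <= 1 -> calM p t = limit t.
Proof.
move=> t01; have cE : curve p = limit_graph.
  by apply: xget_unique => [|E]; [exact: limit_graph_invariant|
    exact: invariant_unique].
rewrite /calM cE; apply: xget_unique => /= [|y [s _ [-> ->]]//].
by exists t => //=; rewrite in_itv.
Qed.

End limit_curve.

(** * Convergence of the sheared graphs *)

Section convergence.
Context {R : realType}.
Implicit Types (s t p q c d e r eta : R) (n k j N : nat).

(** The sheared graph of a tower, normalised by its corner rather than by its
    maximum, so that gluing becomes exactly the functional equation of the limit
    curve, up to the value of the parameter and of the two ratios. *)
Definition profile n k t : R := dev (word n k) t / kink n k.

(** Both ratios of corners that occur when two towers are glued are values of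
    this function, at arguments exchanged by the symmetry of the triangle. *)
Definition kink_ratio n c : R := c * (n%:R + 1) / (n%:R * (n%:R - 1)).

Lemma kink_neq0 n k : (0 < k < n)%N -> kink n k != 0 :> R.
Proof. by move=> kn; rewrite gt_eqF// kink_gt0. Qed.

Lemma kinkL n k : (0 < k < n)%N ->
  kink n k = kink_ratio n k%:R * kink n.+1 k.+1 :> R.
Proof.
move=> /andP[k0 kn]; rewrite /kink /kink_ratio.
have n0 : (0 < n)%N by exact: leq_ltn_trans kn.
rewrite (bin_mull k n0).
have n1 : 0 < n%:R - 1 :> R by rewrite subr_gt0 ltr1n (leq_ltn_trans k0).
rewrite -(natr1 n) -(natr1 k); field.
by rewrite addrK !gt_eqF//; lra.
Qed.

Lemma kinkR n k : (0 < k)%N -> (k.+1 < n)%N ->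
  kink n k.+1 = kink_ratio n (n%:R - k.+1%:R) * kink n.+1 k.+1 :> R.
Proof.
move=> k0 kn; rewrite /kink /kink_ratio.
rewrite (bin_mulr (ltnW (ltnW kn))).
have n1 : 0 < n%:R - 1 :> R by rewrite subr_gt0 ltr1n (leq_ltn_trans k0)// ltnW.
rewrite -(natr1 n) -(natr1 k); field.
by rewrite addrK !gt_eqF//; lra.
Qed.

Lemma profileL n k s : (0 < k)%N -> (k.+1 < n)%N -> 0 <= s <= 1 ->
  profile n.+1 k.+1 (k.+1%:R / n.+1%:R * s) =
  kink_ratio n k%:R * profile n k s + s.
Proof.
move=> k0 kn s01; have kn' := ltnW kn; rewrite /profile dev_wordL ?(ltnW kn)//; last first.
  exact: leq_ltn_trans kn'.
have D1 : kink n k != 0 :> R by rewrite kink_neq0// k0.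
have D2 : kink n.+1 k.+1 != 0 :> R by rewrite kink_neq0//= ltnS.
have e := @kinkL n k; rewrite k0 kn' in e.
rewrite mulrDl mulrAC divff// mul1r; congr (_ + _).
have D3 : kink_ratio n k%:R != 0 :> R.
  by apply: contraNneq D1 => e0; rewrite e// e0 mul0r.
by rewrite e//; field; rewrite D2 D3.
Qed.

Lemma profileR n k s : (0 < k)%N -> (k.+1 < n)%N -> 0 <= s <= 1 ->
  let q := k.+1%:R / n.+1%:R in
  profile n.+1 k.+1 (q + (1 - q) * s) =
  kink_ratio n (n%:R - k.+1%:R) * profile n k.+1 s + (1 - s).
Proof.
move=> k0 kn s01 q; have kn' := ltnW kn.
rewrite /profile dev_wordR ?(ltnW kn)//; last exact: leq_ltn_trans kn'.
have D1 : kink n k.+1 != 0 :> R by rewrite kink_neq0.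
have D2 : kink n.+1 k.+1 != 0 :> R by rewrite kink_neq0//= ltnS.
have e := @kinkR n k k0 kn.
rewrite mulrDl mulrAC divff// mul1r; congr (_ + _).
have D3 : kink_ratio n (n%:R - k.+1%:R) != 0 :> R.
  by apply: contraNneq D1 => e0; rewrite e// e0 mul0r.
by rewrite e//; field; rewrite D2 D3.
Qed.

(** By the symmetry of [kink_ratio] this serves for the left part, with [c = k],
    and for the right part, with [c = n - k - 1]; the constant 10 leaves room for
    all [n >= 2]. *)
Lemma kink_ratio_near n c : (1 < n)%N -> 0 <= c <= n%:R ->
  `|kink_ratio n c - (c + 1) / (n%:R + 1)| <= 10 / n%:R.
Proof.
move=> n1 /andP[c0 cn]; have n2 : 2 <= n%:R :> R by rewrite ler_nat.
rewrite /kink_ratio; move: (n%:R : R) n2 cn => x x2 cx.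
have D : 0 < x * (x - 1) * (x + 1) by rewrite !mulr_gt0//; lra.
have e1 : 10 / x - (c * (x + 1) / (x * (x - 1)) - (c + 1) / (x + 1)) =
    (10 * (x ^+ 2 - 1) - (3 * c * x + c - x ^+ 2 + x)) / (x * (x - 1) * (x + 1)).
  by field; rewrite !gt_eqF//; lra.
have e2 : 10 / x + (c * (x + 1) / (x * (x - 1)) - (c + 1) / (x + 1)) =
    (10 * (x ^+ 2 - 1) + (3 * c * x + c - x ^+ 2 + x)) / (x * (x - 1) * (x + 1)).
  by field; rewrite !gt_eqF//; lra.
rewrite ler_norml; apply/andP; split.
  by rewrite -subr_ge0 opprK addrC e2 divr_ge0 ?(ltW D)//; nra.
by rewrite -subr_ge0 e1 divr_ge0 ?(ltW D)//; nra.
Qed.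

Lemma profile_le n k t : (0 < k < n)%N -> 0 <= t <= 1 ->
  `|profile n k t| <= n%:R ^+ 3 / (k%:R * (n%:R - k%:R)).
Proof.
move=> kn t01; have /andP[k0 kn'] := kn.
have n0 : (0 < n)%N by exact: leq_ltn_trans kn'.
rewrite /profile normrM normfV (gtr0_norm (kink_gt0 kn)) ler_pdivrMr ?kink_gt0//.
apply: (le_trans (dev_le (@word_le1 _ n k) t01)); rewrite size_word//.
have k1 : 0 < k%:R :> R by rewrite ltr0n.
have k2 : 0 < n%:R - k%:R :> R by rewrite subr_gt0 ltr_nat.
have n1 : 1 < n%:R :> R by rewrite ltr1n (leq_ltn_trans k0).
have c0 : 0 <= 'C(n, k)%:R :> R by [].
have -> : n%:R ^+ 3 / (k%:R * (n%:R - k%:R)) * kink n k =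
    2 * 'C(n, k)%:R * (n%:R / (n%:R - 1)) :> R.
  by rewrite /kink; field; rewrite !gt_eqF//; lra.
by rewrite ler_peMr ?mulr_ge0// ler_pdivlMr; lra.
Qed.

(** As [(j + 1) c ^ j] is at most [1 / (1 - c)], a further factor [c ^ j] makes
    it vanish; and [r <= c ^ 2] for [c] half-way between [r] and 1. *)
Lemma arith_geom_vanish r e : 0 <= r -> r < 1 -> 0 < e ->
  exists N, forall j, (N <= j)%N -> j.+1%:R * r ^+ j <= e.
Proof.
move=> r0 r1 e0; pose c := (1 + r) / 2.
have c0 : 0 <= c by rewrite /c; lra.
have c1 : c < 1 by rewrite /c; lra.
have rc : r <= c * c by rewrite /c; nra.
have cj j : 0 <= c ^+ j <= 1 by rewrite exprn_ge0//= exprn_ile1// ltW.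
have bnd j : j.+1%:R * c ^+ j * (1 - c) <= 1 - c ^+ j.+1.
  elim: j => [|j IH]; first by rewrite expr0 expr1; lra.
  have /andP[? ?] := cj j.+1; rewrite -(natr1 j.+1) [c ^+ j.+2]exprS.
  have -> : (j.+1%:R + 1) * c ^+ j.+1 * (1 - c) =
    c * (j.+1%:R * c ^+ j * (1 - c)) + c ^+ j.+1 * (1 - c) by rewrite exprS; ring.
  by nra.
have : c ^+ n @[n --> \oo] --> (0 : R) by apply: cvg_expr; rewrite ger0_norm.
move=> /cvgrPdist_le/(_ (e * (1 - c))); rewrite mulr_gt0 ?subr_gt0// => /(_ isT).
move=> [N _ hN]; exists N => j Nj.
have {hN} := hN j Nj; rewrite sub0r normrN => /ler_normlW h.
have /andP[p0 p1] := cj j; have /andP[q0 q1] := cj j.+1.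
have rj : r ^+ j <= c ^+ j * c ^+ j by rewrite -exprMn lerXn2r// nnegrE// mulr_ge0.
apply: (@le_trans _ _ (j.+1%:R * (c ^+ j * c ^+ j))); first by rewrite ler_wpM2l.
have b := bnd j.
rewrite -(@ler_pM2r _ (1 - c)) ?subr_gt0//; nra.
Qed.

Section step.
Variables (p : R) (p_gt0 : 0 < p) (p_lt1 : p < 1).

Local Notation M := (limit p).
Local Notation rho := (ctr_ratio p).
Local Notation close n k e :=
  (forall t, 0 <= t <= 1 -> `|profile n k t - M t| <= e).

(** Both sides are glued from two halves by the same formula; the ratios differ by
    at most [d], on a curve of height at most [1 / (1 - rho)], and the junctions
    also by at most [d], which costs [eta]. *)
Lemma close_step n k d eta e : (0 < k)%N -> (k.+1 < n)%N -> 0 <= e ->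
  (forall s t, `|s - t| <= d -> `|M s - M t| <= eta) ->
  `|k.+1%:R / n.+1%:R - p| <= d ->
  `|kink_ratio n k%:R - p| <= d ->
  `|kink_ratio n (n%:R - k.+1%:R) - (1 - p)| <= d ->
  close n k e -> close n k.+1 e ->
  close n.+1 k.+1 ((rho + d) * e + (d / (1 - rho) + eta)).
Proof.
move=> k0 kn e0 Meta qp rL rR cL cR t t01; have [p0 p1] := (p_gt0, p_lt1).
set q := _ / _ in qp; have d0 : 0 <= d by exact: le_trans qp.
have q0 : 0 < q by rewrite divr_gt0.
have q1 : q < 1 by rewrite ltr_pdivrMr// mul1r ltr_nat ltnS ltnW.
have [pr qr] := le_ctr_ratio p.
have glued r b a m m' x : 0 <= b -> b <= rho -> `|r - b| <= d ->
    `|a - m| <= e -> 0 <= m <= (1 - rho)^-1 -> `|m' - (b * m + x)| <= eta ->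
    `|r * a + x - m'| <= (rho + d) * e + (d / (1 - rho) + eta).
  move=> b0 brho rb am /andP[m0 mC] m'x.
  have -> : r * a + x - m' = r * (a - m) + ((r - b) * m - (m' - (b * m + x))).
    by ring.
  apply: (le_trans (ler_normD _ _)); apply: lerD.
    rewrite normrM ler_pM//; rewrite -(subrK b r).
    by apply: (le_trans (ler_normD _ _)); rewrite addrC lerD// ger0_norm.
  apply: (le_trans (ler_normB _ _)); apply: lerD => //.
  by rewrite normrM ler_pM// ger0_norm.
have M01 s : 0 <= M s <= (1 - rho)^-1.
  by rewrite limit_ge0// limit_le.
have [s s01 [->|->]] := unit_cover q0 q1 t01.
  rewrite profileL//; apply: (glued _ p _ (M s)) => //; [exact: ltW|exact: cL|].
  rewrite -limitL//; apply: Meta; rewrite -mulrBl normrM.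
  have /andP[s0 s1] := s01; rewrite (ger0_norm s0).
  by rewrite (le_trans _ qp)// ler_piMr.
rewrite profileR//; apply: (glued _ (1 - p) _ (M s)) => //; [lra|exact: cR|].
rewrite -limitR//; apply: Meta.
have -> : q + (1 - q) * s - (p + (1 - p) * s) = (q - p) * (1 - s) by ring.
rewrite normrM; have /andP[s0 s1] := s01.
rewrite (ger0_norm (x := 1 - s)) ?subr_ge0//.
by rewrite (le_trans _ qp)// ler_piMr// gerBl.
Qed.

(** The contraction is iterated [j] times inside a cone around the direction [p];
    the crude bound [profile_le] at the far end grows only linearly in [n] there.
    The condition [20 <= d * N] makes the error [10 / n] on the ratios at most
    [d / 2]. *)
Lemma close_iter d eta N : 0 < d -> d <= (1 - rho) / 2 -> 0 <= eta ->
  20 <= d * N%:R ->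
  (forall s t, `|s - t| <= d -> `|M s - M t| <= eta) ->
  forall j n k, (N + j <= n)%N ->
  `|k%:R - p * n%:R| + 2 * j%:R <= d / 2 * n%:R ->
  close n k ((rho + d) ^+ j * ((4 / (1 - rho) ^+ 2 + (1 - rho)^-1) * n%:R)
             + 2 * (d / (1 - rho) + eta) / (1 - rho)).
Proof.
move=> d0 dr eta0 dN Meta; have [p0 p1] := (p_gt0, p_lt1).
have [pr qr] := le_ctr_ratio p; have r1 := ctr_ratio_lt1 p_gt0 p_lt1.
have r0 := ctr_ratio_gt0 p_gt0.
set mu := 1 - rho in dr *; have mu0 : 0 < mu by rewrite subr_gt0.
have pmu : mu <= p by rewrite /mu; lra.
have qmu : mu <= 1 - p by rewrite /mu; lra.
set C := 4 / mu ^+ 2 + mu^-1; set E := 2 * (d / mu + eta) / mu.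
have C0 : 0 <= C by rewrite addr_ge0 ?invr_ge0 ?divr_ge0 ?exprn_ge0 ?(ltW mu0).
have E0 : 0 <= E.
  by rewrite /E divr_ge0 ?(ltW mu0)// mulr_ge0// addr_ge0// divr_ge0// ltW.
(* the cone stays away from the two sides of the triangle *)
have inner n k : (N <= n)%N -> `|k%:R - p * n%:R| <= d / 2 * n%:R ->
    [/\ 20 <= d * n%:R, mu / 2 * n%:R <= k%:R & mu / 2 * n%:R <= n%:R - k%:R].
  move=> Nn; have Nn' : N%:R <= n%:R :> R by rewrite ler_nat.
  rewrite ler_norml => /andP[h1 h2]; split.
  - by rewrite (le_trans dN)// ler_pM2l.
  - by have := ler0n R n; nra.
  - by have := ler0n R n; nra.
elim=> [|j IH] n k Nn hk t t01.
  rewrite addn0 in Nn; rewrite mulr0 addr0 in hk.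
  have [dn kn1 kn2] := inner _ _ Nn hk.
  have n20 : 20 <= mu * n%:R by have := ler0n R n; nra.
  have kpos : 0 < k%:R :> R by nra.
  have kpos' : 0 < n%:R - k%:R :> R by nra.
  have kn : (0 < k < n)%N by rewrite -(ltr0n R) kpos /= -(ltr_nat R) -subr_gt0.
  have npos : 0 < n%:R :> R by lra.
  have n1 : 1 <= n%:R :> R by rewrite ler1n; case/andP: kn => _; apply: leq_ltn_trans.
  rewrite expr0 mul1r; apply: (@le_trans _ _ (C * n%:R)); last by rewrite lerDl.
  apply: (le_trans (ler_normB _ _)); rewrite /C mulrDl; apply: lerD; last first.
    rewrite ger0_norm ?limit_ge0//; apply: (le_trans (limit_le _ _ _)) => //.
    by rewrite ler_peMr// invr_ge0 ltW.
  apply: (le_trans (profile_le kn t01)).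
  rewrite ler_pdivrMr ?mulr_gt0//.
  have -> : n%:R ^+ 3 = 4 / mu ^+ 2 * n%:R * (mu / 2 * n%:R * (mu / 2 * n%:R)) :> R.
    by field; rewrite gt_eqF.
  rewrite ler_wpM2l//; first by rewrite mulr_ge0// divr_ge0// exprn_ge0// ltW.
  by rewrite ler_pM// mulr_ge0// divr_ge0// ltW.
(* one row back, the deviation grows by at most 1 and the cone narrows by
   [d / 2 <= 1], which the term [2 * j] absorbs *)
case: n Nn hk => [|n]; first by rewrite addnS.
rewrite addnS ltnS => Nn hk.
have Nn' : (N <= n)%N by exact: leq_trans (leq_addr _ _) Nn.
have hk' : `|k%:R - p * n.+1%:R| <= d / 2 * n.+1%:R.
  by apply: le_trans hk; rewrite lerDl mulr_ge0.
have [dn kn1 kn2] := inner _ _ (leqW Nn') hk'.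
have dN' : 20 <= d * n%:R by rewrite (le_trans dN)// ler_pM2l// ler_nat.
have n20 : 20 <= mu * n%:R by have := ler0n R n; nra.
have Sn : n.+1%:R = n%:R + 1 :> R by rewrite natr1.
case: k hk hk' kn1 kn2 => [|k] hk hk' kn1 kn2.
  by move: kn1; rewrite Sn; nra.
have Sk : k.+1%:R = k%:R + 1 :> R by rewrite natr1.
have k0 : (0 < k)%N by rewrite -(ltr0n R); nra.
have kn : (k.+1 < n)%N by rewrite -(ltr_nat R); nra.
have npos : 0 < n%:R :> R by rewrite ltr0n (leq_ltn_trans _ kn).
have n1 : (1 < n)%N by exact: leq_ltn_trans kn.
have near10 : 10 / n%:R <= d / 2 by rewrite ler_pdivrMr//; lra.
have qp : `|k.+1%:R / n.+1%:R - p| <= d / 2.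
  have -> : k.+1%:R / n.+1%:R - p = (k.+1%:R - p * n.+1%:R) / n.+1%:R :> R.
    by field; rewrite nat1r pnatr_eq0.
  by rewrite normrM normfV (ger0_norm (x := n.+1%:R))// ler_pdivrMr.
set e := (rho + d) ^+ j * (C * n%:R) + E.
have rd0 : 0 <= rho + d by lra.
have e0 : 0 <= e by rewrite addr_ge0// mulr_ge0 ?exprn_ge0// mulr_ge0.
apply: (@le_trans _ _ ((rho + d) * e + (d / mu + eta))).
  apply: close_step => //.
  - by apply: le_trans qp _; lra.
  - rewrite -(subrK ((k%:R + 1) / (n%:R + 1)) (kink_ratio _ _)) -addrA.
    apply: (le_trans (ler_normD _ _)); rewrite Sk Sn in qp.
    have hc : 0 <= (k%:R : R) <= n%:R by rewrite ler0n/= ler_nat ltnW// ltnW.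
    by have := kink_ratio_near n1 hc; lra.
  - have hc : 0 <= (n%:R - k.+1%:R : R) <= n%:R.
      by rewrite subr_ge0 ler_nat ltnW//= gerBl.
    have := kink_ratio_near n1 hc.
    have -> : (n%:R - k.+1%:R + 1) / (n%:R + 1) = 1 - k.+1%:R / n.+1%:R :> R.
      by rewrite Sn; field; rewrite gt_eqF//; lra.
    move: qp; move: (k.+1%:R / n.+1%:R) (kink_ratio _ _) => q r.
    by rewrite !ler_norml => /andP[? ?] /andP[? ?]; apply/andP; split; lra.
  - apply: IH => //; move: hk; rewrite Sk Sn -(natr1 j).
    have : `|k%:R - p * n%:R| <= `|k%:R + 1 - p * (n%:R + 1)| + 1.
      have -> : k%:R - p * n%:R = (k%:R + 1 - p * (n%:R + 1)) + (p - 1) by ring.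
      apply: (le_trans (ler_normD _ _)); rewrite lerD2l ler_norml.
      by apply/andP; split; lra.
    have : d <= 1 by rewrite (le_trans dr)// /mu; lra.
    by lra.
  - apply: IH => //; move: hk; rewrite Sk Sn -(natr1 j).
    have : `|k%:R + 1 - p * n%:R| <= `|k%:R + 1 - p * (n%:R + 1)| + 1.
      have -> : k%:R + 1 - p * n%:R = (k%:R + 1 - p * (n%:R + 1)) + p by ring.
      apply: (le_trans (ler_normD _ _)); rewrite lerD2l ler_norml.
      by apply/andP; split; lra.
    have : d <= 1 by rewrite (le_trans dr)// /mu; lra.
    by lra.
rewrite /e mulrDr mulrA -exprS -addrA; apply: lerD.
  rewrite ler_wpM2l ?exprn_ge0// ler_wpM2l// Sn; lra.
(* the bound on the accumulated error is a super-solution of its recursion *)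
have -> : d / mu + eta = mu / 2 * E by rewrite /E; field; rewrite gt_eqF.
have : rho + d <= 1 - mu / 2 by rewrite /mu in dr *; lra.
by nra.
Qed.

Lemma close_eventually e : 0 < e -> exists2 c, 0 < c & exists N,
  forall n k, (N <= n)%N -> `|k%:R / n%:R - p| <= c ->
  (0 < k < n)%N /\ close n k e.
Proof.
move=> e0; have [p0 p1] := (p_gt0, p_lt1).
have [pr qr] := le_ctr_ratio p; have r1 := ctr_ratio_lt1 p_gt0 p_lt1.
have r0 := ctr_ratio_gt0 p_gt0.
set mu := 1 - rho; have mu0 : 0 < mu by rewrite subr_gt0.
have mu1 : mu < 1 by rewrite /mu; lra.
(* both [d / mu] and the modulus are then at most [eta], and the accumulated error
   [2 * (eta + eta) / mu] is [e / 2] *)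
pose eta := e * mu / 8; have eta0 : 0 < eta by rewrite !divr_gt0// mulr_gt0.
have [d1 d10 hd1] := limit_unif_continuous p_gt0 p_lt1 eta0.
pose d := Num.min d1 (Num.min (mu / 2) (eta * mu)).
have d0 : 0 < d by rewrite !lt_min d10 divr_gt0//= mulr_gt0.
have dd1 : d <= d1 by rewrite ge_min lexx.
have dmu : d <= mu / 2 by rewrite !ge_min lexx orbT.
have deta : d <= eta * mu by rewrite !ge_min lexx !orbT.
have E2 : 2 * (d / mu + eta) / mu <= e / 2.
  rewrite ler_pdivrMr//.
  have : d / mu <= eta by rewrite ler_pdivrMr.
  by rewrite /eta; lra.
set C := 4 / mu ^+ 2 + mu^-1.
have C0 : 0 < C.
  by rewrite addr_gt0 ?invr_gt0// divr_gt0// exprn_gt0.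
have rd0 : 0 <= rho + d by lra.
have rd1 : rho + d < 1 by have : mu = 1 - rho by []; lra.
have e8 : 0 < e / 2 / (C * (8 / d)) by rewrite !divr_gt0// mulr_gt0// divr_gt0.
have [J hJ] := arith_geom_vanish rd0 rd1 e8.
have Meta s t : `|s - t| <= d -> `|M s - M t| <= eta.
  by move=> st; apply: hd1; exact: le_trans dd1.
pose N0 := (Num.truncn (20 / d)).+1.
have N0d : 20 <= d * N0%:R.
  by rewrite mulrC -ler_pdivrMr// ltW// truncnS_gt.
exists (d / 4); first by rewrite divr_gt0.
exists (2 * N0 + (Num.truncn (8 / d * J.+1%:R)).+1)%N => n k Nn kp.
have [n1 n2] : (2 * N0 <= n)%N /\ 8 / d * J.+1%:R < n%:R.
  split; first exact: leq_trans (leq_addr _ _) Nn.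
  apply: (lt_le_trans (truncnS_gt _)); rewrite ler_nat.
  exact: leq_trans (leq_addl _ _) Nn.
have npos : 0 < n%:R :> R.
  by rewrite ltr0n (leq_trans _ n1)// muln_gt0.
(* half of the width of the cone is left to the initial deviation of [k], the
   other half to the [j] steps back *)
pose j := Num.truncn (d * n%:R / 8).
have /andP[j1 j2] : j%:R <= d * n%:R / 8 < j.+1%:R.
  by apply: truncn_itv; rewrite divr_ge0// mulr_ge0// ltW.
have kn : `|k%:R - p * n%:R| <= d / 4 * n%:R.
  have -> : k%:R - p * n%:R = (k%:R / n%:R - p) * n%:R :> R.
    by field; rewrite gt_eqF.
  by rewrite normrM (ger0_norm (x := n%:R))// ler_wpM2r.
have N0n : 2 * N0%:R <= n%:R :> R by rewrite -natrM ler_nat.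
have d1' : d <= 1 by lra.
split.
  have N0pos : 0 < N0%:R :> R by rewrite ltr0n.
  have dn : 20 <= d * n%:R by nra.
  move: kn; rewrite ler_norml => /andP[h1 h2].
  have mun : d * n%:R <= mu / 2 * n%:R by rewrite ler_pM2r.
  have pn : mu * n%:R <= p * n%:R by rewrite ler_pM2r// /mu; lra.
  have qn : mu * n%:R <= (1 - p) * n%:R by rewrite ler_pM2r// /mu; lra.
  by rewrite -(ltr0n R) -(ltr_nat R); apply/andP; split; lra.
move=> t t01.
have Nj : (N0 + j <= n)%N.
  rewrite -(ler_nat R) natrD.
  have : d * n%:R <= n%:R by rewrite ler_piMl.
  by lra.
have hk : `|k%:R - p * n%:R| + 2 * j%:R <= d / 2 * n%:R by lra.
apply: (le_trans (close_iter d0 dmu (ltW eta0) N0d Meta Nj hk t01)).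
rewrite -/mu -/C; have -> : e = e / 2 + e / 2 by field.
apply: lerD => //.
have Jj : (J <= j)%N.
  rewrite -ltnS -(ltr_nat R); apply: le_lt_trans j2.
  move: n2; rewrite mulrAC ltr_pdivrMr// => n2.
  have : J%:R <= J.+1%:R :> R by rewrite ler_nat.
  by lra.
have := hJ _ Jj; rewrite ler_pdivlMr; last by rewrite mulr_gt0// divr_gt0.
apply: le_trans.
have -> : j.+1%:R * (rho + d) ^+ j * (C * (8 / d)) =
  (rho + d) ^+ j * (C * (8 / d * j.+1%:R)) by ring.
rewrite ler_wpM2l ?exprn_ge0//.
rewrite ler_pM2l// mulrAC ler_pdivlMr//; lra.
Qed.

End step.
End convergence.

(** * The norm of [L^oo([0, 1])] and the theorem *)

Section Linf.
Context {R : realType}.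
Implicit Types (f g : R -> R) (t c : R).

Let mu := mrestr (@lebesgue_measure R) (measurable_itv `[0, 1]).

Lemma mu_unit_gt0 : (0 < mu [set: R])%E.
Proof.
by rewrite /mu /mrestr setTI lebesgue_measure_itv/= lte_fin ltr01 oppr0 adde0.
Qed.

Lemma Linf01E f : Linf01 f = ess_sup mu (abse \o (EFin \o f)).
Proof. by rewrite /Linf01 unlock mu_unit_gt0. Qed.

Lemma Linf01_ge0 f : (0 <= Linf01 f)%E.
Proof. exact: Lnorm_ge0. Qed.

Lemma Linf01_le f c : (forall t, 0 <= t <= 1 -> `|f t| <= c) ->
  (Linf01 f <= c%:E)%E.
Proof.
move=> fc; rewrite Linf01E; apply/ess_supP.
exists (~` `[0, 1]%classic); split.
- by apply: measurableC; exact: measurable_itv.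
- by rewrite -[LHS]/(lebesgue_measure (~` `[0, 1]%classic `&` `[0, 1]%classic)) setICl measure0.
- move=> t /= h; apply: contra_not h; rewrite in_itv/= => t01.
  by rewrite lee_fin fc.
Qed.

(** An essential bound of a continuous function holds everywhere: near a point of
    [[0, 1]] where it fails, it fails on an interval. *)
Lemma le_Linf01 f g t : {for t, continuous g} ->
  (forall s, 0 <= s <= 1 -> f s = g s) -> 0 <= t <= 1 ->
  (`|g t|%:E <= Linf01 f)%E.
Proof.
move=> gt fg /andP[t0 t1]; rewrite leNgt; apply/negP => lt.
have fin : Linf01 f \is a fin_num.
  by rewrite ge0_fin_numE ?Linf01_ge0// (lt_trans lt)// ltry.
have : (ess_sup mu (abse \o (EFin \o f)) <= Linf01 f)%E by rewrite -Linf01E.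
move=> /ess_supP.
move: lt; rewrite -(fineK fin); set c := fine _; rewrite lte_fin => cg.
have : \forall s \near t, c < `|g s|.
  have cvg_g : `|g s| @[s --> t] --> `|g t| by exact: cvg_norm.
  exact: cvgr_gt cvg_g _ cg.
move=> /nbhs_ballP[e /= e0 ball_e] [N [mN N0 subN]].
pose a := Num.max 0 (t - e); pose b := Num.min 1 (t + e).
have ab : a < b by rewrite /a /b gt_max !lt_min; apply/andP; split; apply/andP; split; lra.
have sub : `]a, b[%classic `<=` N.
  move=> s /=; rewrite in_itv/= /a /b gt_max lt_min.
  move=> /andP[/andP[s0 sa] /andP[s1 sb]].
  apply: subN => /=; rewrite lee_fin fg; last by rewrite !ltW.
  apply/negP; rewrite -ltNge; apply: ball_e.
  by rewrite /ball /= ltr_norml; apply/andP; split; lra.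
have sub' : `]a, b[%classic `<=` N `&` `[0, 1]%classic.
  move=> s sab; split; first exact: sub.
  move: sab; rewrite /= !in_itv/= /a /b gt_max lt_min.
  by move=> /andP[/andP[s0 sa] /andP[s1 sb]]; rewrite !ltW.
have : (lebesgue_measure (`]a, b[%classic : set R) <= 0)%E.
  rewrite -N0 /mu /mrestr; apply: le_measure => //; rewrite inE.
    exact: measurable_itv.
  by apply: measurableI => //; exact: measurable_itv.
by rewrite lebesgue_measure_itv/= lte_fin ab -EFinB lee_fin subr_le0 leNgt ab.
Qed.

End Linf.

(** Normalising two functions by their maxima turns closeness up to the common
    factor [D] into closeness; [r] and [m] are any numbers known only as least
    upper bounds. *)
Lemma normalized_close (R : realType) (b M : R -> R) (D r m e : R) :
  0 < D -> 1 <= m -> 0 <= e <= 2^-1 ->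
  (forall t : R, 0 <= t <= 1 -> 0 <= M t <= m) ->
  (forall c : R, (forall t : R, 0 <= t <= 1 -> M t <= c) -> m <= c) ->
  (forall t : R, 0 <= t <= 1 -> `|b t| <= r) ->
  (forall c : R, (forall t : R, 0 <= t <= 1 -> `|b t| <= c) -> r <= c) ->
  (forall t : R, 0 <= t <= 1 -> `|b t / D - M t| <= e) ->
  0 < r /\ forall t : R, 0 <= t <= 1 -> `|b t / r - M t / m| <= 4 * e.
Proof.
move=> D0 m1 /andP[e0 e2] Mm mle br rle bM.
have m0 : 0 < m by lra.
have bDM t : 0 <= t <= 1 -> `|b t - D * M t| <= D * e.
  move=> t01; have -> : b t - D * M t = D * (b t / D - M t).
    by field; rewrite gt_eqF.
  by rewrite normrM (gtr0_norm D0) ler_pM2l// bM.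
have rDm : r <= D * m + D * e.
  apply: rle => t t01; have /andP[M0 M1] := Mm t t01.
  rewrite -(subrK (D * M t) (b t)); apply: (le_trans (ler_normD _ _)).
  rewrite addrC lerD// ?bDM// ger0_norm ?mulr_ge0 ?(ltW D0)//.
  by rewrite ler_pM2l.
have Dmr : D * m <= r + D * e.
  rewrite mulrC -ler_pdivlMr//; apply: mle => t t01.
  rewrite ler_pdivlMr// mulrC; have := bDM t t01; have := br t t01.
  by rewrite !ler_norml => /andP[? ?] /andP[? ?]; lra.
have Dr : D / 2 <= r by nra.
have r0 : 0 < r by apply: lt_le_trans Dr; rewrite divr_gt0.
split=> // t t01; have /andP[M0 M1] := Mm t t01.
(* the defect [D * m - r] is paid with a factor [M t / m] in [[0, 1]] *)
have -> : b t / r - M t / m = ((b t - D * M t) + M t / m * (D * m - r)) / r.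
  by field; rewrite !gt_eqF.
rewrite normrM normfV (gtr0_norm r0) ler_pdivrMr//.
apply: (le_trans (ler_normD _ _)).
have h1 := bDM t t01.
have h2 : `|M t / m * (D * m - r)| <= D * e.
  rewrite normrM ger0_norm ?divr_ge0 ?(ltW m0)//.
  apply: (@le_trans _ _ (1 * `|D * m - r|)).
    by rewrite ler_wpM2r// ler_pdivrMr// mul1r.
  by rewrite mul1r ler_norml; apply/andP; split; lra.
by nra.
Qed.

(** The crude bound on bridges makes the supremum in [renorm] a genuine one. *)
Lemma renorm_lub (R : realType) n k (x : R) :
  let b := bridge g0 x 'C(n, k) in
  let r := sup [set `|b t| | t in `[0, 1]%classic] in
  (0 < n)%N -> tower_basis n k x ->
  (forall t : R, 0 <= t <= 1 -> `|b t| <= r) /\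
  (forall c : R, (forall t : R, 0 <= t <= 1 -> `|b t| <= c) -> r <= c).
Proof.
move=> b r n0 bx; split=> [t t01|c hc].
  apply: ub_le_sup; last by exists t => //=; rewrite in_itv.
  exists (2 * (size (word n k : seq R))%:R) => _ [s + <-].
  rewrite /= in_itv/= => s01; rewrite /b (bridge_word n0 bx s01).
  by apply: dev_le => // a; exact: word_le1.
apply: ge_sup => [|_ [t + <-]]; last by rewrite /= in_itv/= => /hc.
by exists `|b 0|; exists 0 => //=; rewrite in_itv/= lexx ler01.
Qed.

(** Continuity identifies the norm with the maximum, and the curve passes through
    the point [(p, 1)], the image of its right end under [alphaL]. *)
Lemma Linf01_calM_lub (R : realType) (p : R) : 0 < p -> p < 1 ->
  let m := fine (Linf01 (calM p)) in
  [/\ 1 <= m, forall t : R, 0 <= t <= 1 -> 0 <= calM p t <= m &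
     forall c : R, (forall t : R, 0 <= t <= 1 -> calM p t <= c) -> m <= c].
Proof.
move=> p0 p1 m.
have M0 t : 0 <= t <= 1 -> 0 <= calM p t.
  by move=> t01; rewrite calM_limit// limit_ge0.
have leE c : (forall t : R, 0 <= t <= 1 -> calM p t <= c) -> (Linf01 (calM p) <= c%:E)%E.
  by move=> hc; apply: Linf01_le => t t01; rewrite ger0_norm ?M0// hc.
have mE : Linf01 (calM p) = m%:E.
  rewrite /m fineK// ge0_fin_numE ?Linf01_ge0//.
  apply: (@le_lt_trans _ _ (1 - ctr_ratio p)^-1%:E); last exact: ltry.
  by apply: leE => t t01; rewrite calM_limit// limit_le.
have Mm t : 0 <= t <= 1 -> calM p t <= m.
  move=> t01; rewrite -lee_fin -mE -(ger0_norm (M0 t t01)).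
  rewrite (calM_limit p0 p1 t01); apply: le_Linf01 => //.
    exact: limit_continuous.
  by move=> s s01; exact: calM_limit.
split=> [|t t01|c hc]; last by rewrite -lee_fin -mE leE.
  have p01 : 0 <= p <= 1 by rewrite !ltW.
  by have := Mm p p01; rewrite calM_limit// limit_p.
by rewrite M0// Mm.
Qed.

Theorem theorem2p2 (R : realType) (p : R) (p_gt0 : 0 < p) (p_lt1 : p < 1)
    (k : nat -> nat) (k_le : forall n, (k n <= n)%N)
    (k_cvg : ((k n)%:R / n%:R : R) @[n --> \oo] --> p)
    (x : nat -> R) (x_basis : forall n, (0 < n)%N -> tower_basis n (k n) (x n)) :
  Linf01 (fun t => phi g0 (x n) 'C(n, k n) t - calM p t / fine (Linf01 (calM p)))
    @[n --> \oo] --> (0 : \bar R)%E.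
Proof.
have [m1 Mm mle] := Linf01_calM_lub p_gt0 p_lt1.
set m := fine _ in m1 Mm mle *.
have main (e : R) : 0 < e -> \forall n \near \oo,
    (Linf01 (fun t => phi g0 (x n) 'C(n, k n) t - calM p t / m)%R <= e%:E)%E.
  move=> e0; pose d := Num.min 2^-1 (e / 4).
  have d0 : 0 < d by rewrite lt_min invr_gt0 ltr0n divr_gt0.
  have d2 : d <= 2^-1 by rewrite ge_min lexx.
  have d4 : 4 * d <= e.
    by rewrite mulrC -ler_pdivlMr// ge_min lexx orbT.
  have [c c0 [N hN]] := close_eventually p_gt0 p_lt1 d0.
  have /cvgrPdist_le/(_ c c0) kp := k_cvg.
  near=> n.
  have [kn cl] : (0 < k n < n)%N /\ forall t, 0 <= t <= 1 ->
      `|profile n (k n) t - limit p t| <= d.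
    apply: hN; first by near: n; exact: nbhs_infty_ge.
    by rewrite distrC; near: n.
  have n0 : (0 < n)%N by case/andP: kn => _; exact: leq_ltn_trans.
  have bx := x_basis n n0.
  have [br rle] := renorm_lub n0 bx.
  have D0 : 0 < kink n (k n) :> R by exact: kink_gt0.
  have bM t : 0 <= t <= 1 ->
      `|bridge g0 (x n) 'C(n, k n) t / kink n (k n) - calM p t| <= d.
    by move=> t01; rewrite (bridge_word n0 bx t01) calM_limit//; exact: cl.
  have d02 : 0 <= d <= 2^-1 by rewrite ltW.
  have [r0 close] := normalized_close D0 m1 d02 Mm mle br rle bM.
  apply: Linf01_le => t t01; apply: le_trans d4.
  by rewrite /phi /renorm gt_eqF//; exact: close.
apply/fine_cvgP; split.
  near=> n; rewrite ge0_fin_numE ?Linf01_ge0//.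
  apply: (@le_lt_trans _ _ 1%:E); last exact: ltry.
  by near: n; exact: main.
apply/cvgrPdist_le => e e0; near=> n.
rewrite sub0r normrN ger0_norm ?fine_ge0 ?Linf01_ge0//.
have h : (Linf01 (fun t => phi g0 (x n) 'C(n, k n) t - calM p t / m)%R <= e%:E)%E.
  by near: n; exact: main.
rewrite -lee_fin fineK// ge0_fin_numE ?Linf01_ge0//.
exact: le_lt_trans h (ltry _).
Unshelve. all: by end_near.
Qed.
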